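(* (First Isomorphism Theorem for schemes.) Let $S$ and $T$ be association schemes on finite sets $X$ and $Y$, and let $\phi$ be an admissible morphism from $S$ to $T$. Let $K=\ker\phi$. Then: (1) $K$ is a normal closed subset of $S$. (2) $\phi(S)=\{\phi(s):s\in S\}$ is a closed subset of $T$ and $\phi(X)=\{\phi(x):x\in X\}$ is a geometric coset of $\phi(S)$; hence $\operatorname{im}\phi:=\{\phi(s)\cap(\phi(X)\times\phi(X)):s\in S\}$ is the subscheme of $T$ on $\phi(X)$ determined by the closed subset $\phi(S)$ and its geometric coset $\phi(X)$. (3) The assignment $\bar\phi(xK)=\phi(x)$ for $x\in X$ and $\bar\phi(s^K)=\phi(s)\cap(\phi(X)\times\phi(X))$ for $s\in S$ gives a well-defined isomorphism of schemes $\bar\phi$ from $S/\!/K$ (on $X/K$) to $\operatorname{im}\phi$ (on $\phi(X)$), and $\phi=\iota\circ\bar\phi\circ\pi_K$, where $\pi_K:S\to S/\!/K$ is given by $\pi_K(x)=xK$, $\pi_K(s)=s^K$, and $\iota:\operatorname{im}\phi\to T$ is the inclusion morphism given by $\iota(y)=y$ for $y\in\phi(X)$ and $\iota(t\cap(\phi(X)\times\phi(X)))=t$ for $t\in\phi(S)$.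
   Context: An association scheme on a finite set $X$ is a partition $S$ of $X\times X$ into nonempty subsets such that $1_X=\{(x,x):x\in X\}\in S$; for each $s\in S$, $s^*=\{(x,y):(y,x)\in s\}\in S$; and for all $p,q,r\in S$ there is an integer $a_{pq}^r\ge 0$ with $|\{y:(x,y)\in p,(y,z)\in q\}|=a_{pq}^r$ whenever $(x,z)\in r$. For $P,Q\subseteq S$ the complex product is $PQ=\{r\in S:a_{pq}^r>0\text{ for some }p\in P,q\in Q\}$ (write $pQ$ for $\{p\}Q$, etc.). A nonempty $T\subseteq S$ is closed if $TT=T$; a closed subset $T$ is normal if $pT=Tp$ for all $p\in S$. For $x\in X$, $s\in S$, let $xs=\{y:(x,y)\in s\}$, and for closed $T$ let $xT=\bigcup_{t\in T}xt$ (a geometric coset of $T$); $X/T$ is the set of geometric cosets. For closed $T$ and a geometric coset $W$ of $T$, the sets $t\cap(W\times W)$ ($t\in T$), when nonempty, form a scheme on $W$ (a subscheme). For closed $T$ and $s\in S$, $s^T=\{(xT,yT):(x',y')\in s\text{ for some }x'\in xT,y'\in yT\}$, and $S/\!/T=\{s^T:s\in S\}$ is a scheme on $X/T$ (the quotient scheme). A morphism from a scheme $S$ on $X$ to a scheme $T$ on $Y$ is a function $\phi:X\cup S\to Y\cup T$ with $\phi(X)\subseteq Y$, $\phi(S)\subseteq T$, and $(\phi(x_1),\phi(x_2))\in\phi(s)$ whenever $(x_1,x_2)\in s$. It is admissible if whenever $x\in X$, $y\in Y$, $s\in S$ and $(\phi(x),y)\in\phi(s)$, there is $x'\in X$ with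 $\phi(x')=y$ and $(x,x')\in s$. Its kernel is $\ker\phi=\{s\in S:\phi(s)=1_Y\}$. An isomorphism is a bijective morphism. *)

(* Defs.v *)
From mathcomp Require Import all_boot.

Set Implicit Arguments.
Unset Strict Implicit.
Unset Printing Implicit Defensive.

(* The finite set underlying a scheme is a subset X : {set U} of an ambient   *)
(* finType U, and relations are sets of pairs over U. A subset of X (for      *)
(* subschemes) and the set of cosets X / T : {set {set U}} (for quotients)    *)
(* then carry schemes in exactly the same sense as X itself.                  *)

Section Schemes.
Variable U : finType.
Implicit Types (X W : {set U}) (S T P Q : {set {set U * U}}).
Implicit Types (p q r s t : {set U * U}) (x y z : U).

Definition diag X : {set U * U} := [set (x, x) | x in X].

Definition conv s : {set U * U} := [set u | (u.2, u.1) \in s].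

Definition paths p q x z : {set U} :=
  [set y | ((x, y) \in p) && ((y, z) \in q)].

(* [partition] includes the nonemptiness of every member of S; as the diagonal *)
(* is a member, X itself is nonempty.                                          *)
Definition is_scheme X S : Prop :=
  [/\ partition S (setX X X),
      diag X \in S,
      (forall s, s \in S -> conv s \in S)
    & forall p q r, p \in S -> q \in S -> r \in S ->
        exists a : nat, forall x z, (x, z) \in r -> #|paths p q x z| = a].

(* The structure constant a_{pq}^r, read off at some pair of r; by             *)
(* [structure_constE] the choice of pair is irrelevant in a scheme.            *)
Definition structure_const p q r : nat :=
  if [pick u in r] is Some u then #|paths p q u.1 u.2| else 0.

Lemma structure_constE X S p q r x z :
  is_scheme X S -> p \in S -> q \in S -> r \in S -> (x, z) \in r ->
  #|paths p q x z| = structure_const p q r.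
Proof.
case=> _ _ _ reg pS qS rS xzr; rewrite /structure_const.
have [a Ha] := reg p q r pS qS rS.
case: pickP => [[x' z'] /= x'z'r | /(_ (x, z))]; last by rewrite xzr.
by rewrite !Ha.
Qed.

Definition complex_prod S P Q : {set {set U * U}} :=
  [set r in S | [exists p in P, exists q in Q, 0 < structure_const p q r]].

Definition closed_subset S T : Prop :=
  [/\ T \subset S, T != set0 & complex_prod S T T = T].

Definition normal_closed_subset S T : Prop :=
  closed_subset S T /\
  forall p, p \in S -> complex_prod S [set p] T = complex_prod S T [set p].

Definition nbhd x s : {set U} := [set y | (x, y) \in s].

Definition gcoset x T : {set U} := \bigcup_(t in T) nbhd x t.

Definition gcosets X T : {set {set U}} := [set gcoset x T | x in X].

Definition subscheme T W : {set {set U * U}} :=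
  [set t :&: setX W W | t in T & t :&: setX W W != set0].

Definition quotient_rel X T s : {set {set U} * {set U}} :=
  [set w in setX (gcosets X T) (gcosets X T) |
    [exists x' in w.1, exists y' in w.2, (x', y') \in s]].

Definition quotient_scheme X S T : {set {set {set U} * {set U}}} :=
  [set quotient_rel X T s | s in S].

End Schemes.

(* A function X \cup S -> Y \cup T mapping X to Y and S to T is encoded as a   *)
(* pair of functions; only their values on X and on S are meaningful.          *)
Record scheme_map (U V : finType) := SchemeMap {
  pmap_of :> U -> V;
  rmap_of : {set U * U} -> {set V * V} }.

Definition comp_map (U V W : finType)
    (g : scheme_map V W) (f : scheme_map U V) : scheme_map U W :=
  SchemeMap (g \o f) (rmap_of g \o rmap_of f).

Definition eq_map_on (U V : finType) (X : {set U}) (S : {set {set U * U}})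
    (f g : scheme_map U V) : Prop :=
  {in X, f =1 g} /\ {in S, rmap_of f =1 rmap_of g}.

Section Morphisms.
Variables U V : finType.
Variables (X : {set U}) (S : {set {set U * U}}).
Variables (Y : {set V}) (T : {set {set V * V}}).
Implicit Type phi : scheme_map U V.

Definition is_morphism phi : Prop :=
  [/\ forall x, x \in X -> phi x \in Y,
      forall s, s \in S -> rmap_of phi s \in T
    & forall x1 x2 s, s \in S -> (x1, x2) \in s ->
        (phi x1, phi x2) \in rmap_of phi s].

Definition is_admissible phi : Prop :=
  forall x y s, x \in X -> y \in Y -> s \in S ->
    (phi x, y) \in rmap_of phi s ->
    exists x', [/\ x' \in X, phi x' = y & (x, x') \in s].

Definition is_isomorphism phi : Prop :=
  [/\ is_morphism phi,
      {in X &, injective phi}, phi @: X = Y,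
      {in S &, injective (rmap_of phi)} & rmap_of phi @: S = T].

Definition ker_map phi : {set {set U * U}} :=
  [set s in S | rmap_of phi s == diag Y].

Definition im_map phi : {set {set V * V}} :=
  [set rmap_of phi s :&: setX (phi @: X) (phi @: X) | s in S].

End Morphisms.

Definition quotient_map (U : finType) (X : {set U}) (K : {set {set U * U}}) :
    scheme_map U {set U} :=
  SchemeMap (fun x => gcoset x K) (quotient_rel X K).

(* Main.v *)
(* By admissibility, [s^K] relates the fibres of [phi] over [y] and [z] exactly *)
(* when [(y, z)] lies in [phi s]. Hence [S//K] is the pullback of [im phi]      *)
(* along the bijection from fibres to their values, and regularity of [im phi]  *)
(* is inherited from [T], because every path in [phi S] starting in [phi X]     *)
(* stays in [phi X].                                                            *)

Require Import Defs.
From mathcomp Require Import all_boot.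

Set Implicit Arguments.
Unset Strict Implicit.
Unset Printing Implicit Defensive.

(** Two facts drive everything. Members of [T] are disjoint, so one pair of [s] already determines
    [phi s] ([rmap_determined]); and admissibility lifts a pair of [phi s] with one end at [phi x]
    to a pair of [s] at [x] ([lift_target], and [lift_source] through converses).

    Hence a relation is in [K] iff [phi] agrees on the ends of its pairs ([mem_ker]): cosets of [K]
    are the fibres of [phi], and [pK] and [Kp] both consist of the [r] with [phi r = phi p], which
    is normality. Lifting paths shows that [phi S] is closed with coset [phi X], and that [im phi]
    inherits the structure constants of [T] ([im_map_scheme]).

    Finally [s^K] is the pullback of the restriction of [phi s] along the bijection from fibres to
    values ([quotient_rel_pull]). So [S//K] is a scheme by [pull_scheme], and pushing forward along
    that bijection is the isomorphism. *)

Section SchemeTheory.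
Variables (U : finType) (X : {set U}) (S : {set {set U * U}}).
Hypothesis schemeS : is_scheme X S.
Implicit Types (s p q r : {set U * U}) (x y z : U).

(** * Points, relations and triangles in a scheme *)

Lemma mem_diag x y : ((x, y) \in diag X) = (x \in X) && (x == y).
Proof.
apply/imsetP/andP => [[z Xz [-> ->]] | [Xx /eqP <-]]; first by rewrite eqxx.
by exists x.
Qed.

Lemma mem_conv s x y : ((x, y) \in conv s) = ((y, x) \in s).
Proof. by rewrite inE. Qed.

Lemma mem_paths p q x y z :
  (y \in paths p q x z) = ((x, y) \in p) && ((y, z) \in q).
Proof. by rewrite inE. Qed.

Lemma scheme_diag : diag X \in S.
Proof. by case: schemeS. Qed.

Lemma scheme_conv s : s \in S -> conv s \in S.
Proof. by case: schemeS => _ _ + _; apply. Qed.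

Lemma scheme_rel x y : x \in X -> y \in X -> exists2 s, s \in S & (x, y) \in s.
Proof.
case: schemeS => /and3P[/eqP covS _ _] _ _ _ Xx Xy.
have: (x, y) \in cover S by rewrite covS in_setX Xx.
by case/bigcupP=> s; exists s.
Qed.

Lemma scheme_uniq u p q : p \in S -> q \in S -> u \in p -> u \in q -> p = q.
Proof.
case: schemeS => /and3P[_ tiS _] _ _ _ Sp Sq pu qu.
by rewrite -(def_pblock tiS Sp pu) (def_pblock tiS Sq qu).
Qed.

Lemma scheme_dom s x y : s \in S -> (x, y) \in s -> x \in X /\ y \in X.
Proof.
case: schemeS => /and3P[/eqP covS _ _] _ _ _ Ss sxy.
have: (x, y) \in cover S by apply/bigcupP; exists s.
by rewrite covS in_setX => /andP.
Qed.

Lemma scheme_inhab s : s \in S -> exists x y, (x, y) \in s.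
Proof.
case: schemeS => /and3P[_ _ S'0] _ _ _ Ss.
have /set0Pn[[x y] sxy]: s != set0 by apply: contraNneq S'0 => <-.
by exists x, y.
Qed.

Lemma scheme_pointed : exists x, x \in X.
Proof.
have [x [y /(scheme_dom scheme_diag)[Xx _]]] := scheme_inhab scheme_diag.
by exists x.
Qed.

(** Regularity makes the number of such paths constant on [r], so a path over one pair of [r] gives
    one over every pair. *)
Lemma path_transport p q r x y z x' z' :
    p \in S -> q \in S -> r \in S ->
    (x, y) \in p -> (y, z) \in q -> (x, z) \in r -> (x', z') \in r ->
  exists2 y', (x', y') \in p & (y', z') \in q.
Proof.
move=> Sp Sq Sr pxy qyz rxz rxz'.
case: schemeS => _ _ _ /(_ p q r Sp Sq Sr)[a Ea].
have /card_gt0P[y']: 0 < #|paths p q x' z'|.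
  by rewrite (Ea _ _ rxz') -(Ea _ _ rxz); apply/card_gt0P; exists y;
    rewrite mem_paths pxy.
by rewrite inE => /andP[]; exists y'.
Qed.

(** A structure constant is positive exactly when some triangle realizes it, so complex products can
    be handled through points. *)
Lemma complex_prodP (P Q : {set {set U * U}}) r :
    P \subset S -> Q \subset S -> r \in S ->
  reflect (exists p q x y z,
             [/\ p \in P, q \in Q, (x, y) \in p, (y, z) \in q & (x, z) \in r])
          (r \in complex_prod S P Q).
Proof.
move=> /subsetP PS /subsetP QS Sr; rewrite inE Sr /=.
apply: (iffP exists_inP) => [[p Pp /exists_inP[q Qq]] | ].
  have [x [z rxz]] := scheme_inhab Sr.
  rewrite -(structure_constE schemeS (PS _ Pp) (QS _ Qq) Sr rxz).
  by case/card_gt0P=> y; rewrite inE => /andP[pxy qyz]; exists p, q, x, y, z.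
case=> p [q [x [y [z [Pp Qq pxy qyz rxz]]]]].
exists p => //; apply/exists_inP; exists q => //.
rewrite -(structure_constE schemeS (PS _ Pp) (QS _ Qq) Sr rxz).
by apply/card_gt0P; exists y; rewrite mem_paths pxy.
Qed.

Lemma complex_prod_sub (P Q : {set {set U * U}}) : complex_prod S P Q \subset S.
Proof. by apply/subsetP=> r; rewrite inE => /andP[]. Qed.

End SchemeTheory.

(** * Transport of schemes along an injection *)

Section Pullback.
Variables (A B : finType) (g : A -> B) (X : {set A}).

Definition pull_rel (t : {set B * B}) : {set A * A} :=
  [set u in setX X X | (g u.1, g u.2) \in t].

Definition push_rel (s : {set A * A}) : {set B * B} :=
  [set (g u.1, g u.2) | u in s].

Lemma mem_pull_rel t x y :
  ((x, y) \in pull_rel t) = [&& x \in X, y \in X & (g x, g y) \in t].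
Proof. by rewrite inE in_setX andbA. Qed.

Lemma pull_relK (t : {set B * B}) :
  t \subset setX (g @: X) (g @: X) -> push_rel (pull_rel t) = t.
Proof.
move=> /subsetP tX; apply/setP=> -[a b]; apply/imsetP/idP => [[[x y]] | tab].
  by rewrite mem_pull_rel => /and3P[_ _ txy] [-> ->].
have := tX _ tab; rewrite in_setX => /andP[/imsetP[x Xx Ea] /imsetP[y Xy Eb]].
by exists (x, y); rewrite ?mem_pull_rel ?Xx ?Xy -?Ea -?Eb.
Qed.

(** As [g] is a bijection from [X] onto its image, each axiom transfers. This produces the quotient
    scheme out of the image scheme. *)
Lemma pull_scheme (T : {set {set B * B}}) :
    {in X &, injective g} -> is_scheme (g @: X) T ->
  is_scheme X (pull_rel @: T).
Proof.
move=> g_inj schT; have gX x : x \in X -> g x \in g @: X by apply: imset_f.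
split.
- apply/and3P; split.
  + rewrite eqEsubset; apply/andP; split; apply/subsetP=> -[x y].
      case/bigcupP=> _ /imsetP[t _ ->]; rewrite mem_pull_rel in_setX.
      by case/and3P=> -> ->.
    rewrite in_setX => /andP[Xx Xy].
    have [t Tt txy] := scheme_rel schT (gX x Xx) (gX y Xy).
    by apply/bigcupP; exists (pull_rel t);
      rewrite ?imset_f ?mem_pull_rel ?Xx ?Xy.
  + apply/trivIsetP=> _ _ /imsetP[s Ts ->] /imsetP[t Tt ->].
    apply: contraNT => /pred0Pn[[x y] /=].
    rewrite !mem_pull_rel => /andP[/and3P[_ _ sxy] /and3P[_ _ txy]].
    by rewrite (scheme_uniq schT Ts Tt sxy txy).
  + apply/imsetP=> -[t Tt t0]; have [a [b tab]] := scheme_inhab schT Tt.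
    have [/imsetP[x Xx Ea] /imsetP[y Xy Eb]] := scheme_dom schT Tt tab.
    by have := in_set0 (x, y); rewrite t0 mem_pull_rel Xx Xy -Ea -Eb tab.
- apply/imsetP; exists (diag (g @: X)); first exact: scheme_diag schT.
  apply/setP=> -[x y]; rewrite mem_diag mem_pull_rel mem_diag.
  have [Xx | //] := boolP (x \in X); rewrite gX //=.
  have [Xy | X'y] := boolP (y \in X); first by rewrite (inj_in_eq g_inj).
  by apply: contraNF X'y => /eqP <-.
- move=> _ /imsetP[t Tt ->]; apply/imsetP; exists (conv t).
    exact: scheme_conv schT _ Tt.
  by apply/setP=> -[x y]; rewrite mem_conv !mem_pull_rel mem_conv andbCA.
move=> _ _ _ /imsetP[p Tp ->] /imsetP[q Tq ->] /imsetP[r Tr ->].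
have [_ _ _ /(_ p q r Tp Tq Tr)[a Ea]] := schT; exists a => x z.
rewrite mem_pull_rel => /and3P[Xx Xz rxz]; rewrite -(Ea _ _ rxz).
(* Every intermediate point lies in [g @: X], the set carrying [T], so paths correspond under [g];
   injectivity then preserves their number. *)
have -> : paths p q (g x) (g z) = g @: paths (pull_rel p) (pull_rel q) x z.
  apply/setP=> b; rewrite mem_paths; apply/andP/imsetP => [[pxb qbz] | [y]].
    have [_ /imsetP[y Xy Eb]] := scheme_dom schT Tp pxb.
    by exists y; rewrite // mem_paths !mem_pull_rel Xx Xy Xz -Eb pxb.
  by rewrite mem_paths !mem_pull_rel =>
    /andP[/and3P[_ _ pxy] /and3P[_ _ qyz]] ->.
rewrite card_in_imset // => y y'; rewrite !mem_paths !mem_pull_rel.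
by move=> /andP[/and3P[_ Xy _] _] /andP[/and3P[_ Xy' _] _]; apply: g_inj.
Qed.

End Pullback.

(** * Lifting along an admissible morphism *)

Section AdmissibleMorphism.
Variables (U V : finType).
Variables (X : {set U}) (S : {set {set U * U}}).
Variables (Y : {set V}) (T : {set {set V * V}}) (phi : scheme_map U V).
Hypothesis schS : is_scheme X S.
Hypothesis schT : is_scheme Y T.
Hypothesis morph_phi : is_morphism X S Y T phi.
Hypothesis adm_phi : is_admissible X S Y phi.

Local Notation F := (rmap_of phi).
Local Notation K := (ker_map S Y phi).
Local Notation phiX := (phi @: X).
Local Notation phiS := (F @: S).

Lemma morphism_point x : x \in X -> phi x \in Y.
Proof. by case: morph_phi => + _ _; apply. Qed.

Lemma morphism_rel s : s \in S -> F s \in T.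
Proof. by case: morph_phi => _ + _; apply. Qed.

Lemma morphism_pair x y s : s \in S -> (x, y) \in s -> (phi x, phi y) \in F s.
Proof. by case: morph_phi => _ _; apply. Qed.

(** Distinct members of [T] share no pair, so an equality of image relations can be checked at a
    single pair. *)
Lemma rmap_determined s t x y :
  s \in S -> (x, y) \in s -> t \in T -> (phi x, phi y) \in t -> F s = t.
Proof.
move=> Ss sxy Tt; apply: (scheme_uniq schT (morphism_rel Ss) Tt).
exact: morphism_pair.
Qed.

Lemma lift_target x y s :
    x \in X -> s \in S -> (phi x, y) \in F s ->
  exists x', [/\ x' \in X, phi x' = y & (x, x') \in s].
Proof.
move=> Xx Ss Fxy; have [_ Yy] := scheme_dom schT (morphism_rel Ss) Fxy.
exact: adm_phi.
Qed.

Lemma rmap_conv s : s \in S -> F (conv s) = conv (F s).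
Proof.
move=> Ss; have [x [y sxy]] := scheme_inhab schS Ss.
apply: (@rmap_determined _ _ y x); rewrite ?mem_conv //.
- exact: scheme_conv schS _ Ss.
- exact: scheme_conv schT _ (morphism_rel Ss).
- exact: morphism_pair.
Qed.

(** Admissibility moves the second endpoint; applied to [conv s] it moves the first. This is what
    lets [Kp] be treated like [pK]. *)
Lemma lift_source x y s :
    y \in X -> s \in S -> (x, phi y) \in F s ->
  exists x', [/\ x' \in X, phi x' = x & (x', y) \in s].
Proof.
move=> Xy Ss; rewrite -mem_conv -rmap_conv // => Fyx.
have [x' [Xx' Ex' syx']] := lift_target Xy (scheme_conv schS Ss) Fyx.
by exists x'; split=> //; rewrite mem_conv in syx'.
Qed.

(** * The kernel: its cosets, closure and normality *)

Lemma ker_sub : K \subset S.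
Proof. by apply/subsetP=> s; rewrite inE => /andP[]. Qed.

(** If [phi x = phi y], the pair of images lies in both [F s] and the diagonal, which must then
    coincide. *)
Lemma mem_ker s x y : s \in S -> (x, y) \in s -> (s \in K) = (phi x == phi y).
Proof.
move=> Ss sxy; have [Xx Xy] := scheme_dom schS Ss sxy.
rewrite inE Ss /=; apply/eqP/eqP => [Fs | Exy].
  have := morphism_pair Ss sxy; rewrite Fs mem_diag => /andP[_ /eqP //].
apply: (rmap_determined Ss sxy); first exact: scheme_diag schT.
by rewrite mem_diag morphism_point //= Exy.
Qed.

(** Two points of [X] always lie in some relation of [S], and [mem_ker] decides whether it is in
    [K]: cosets are fibres. *)
Lemma mem_gcoset_ker x y :
  x \in X -> (y \in gcoset x K) = (y \in X) && (phi x == phi y).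
Proof.
move=> Xx; apply/bigcupP/andP => [[s Ks] | [Xy Exy]].
  rewrite inE => sxy; have Ss := subsetP ker_sub s Ks.
  by have [_ Xy] := scheme_dom schS Ss sxy; rewrite -(mem_ker Ss sxy).
have [s Ss sxy] := scheme_rel schS Xx Xy.
by exists s; [rewrite (mem_ker Ss sxy) | rewrite inE].
Qed.

Lemma diag_in_ker : diag X \in K.
Proof.
have [x Xx] := scheme_pointed schS.
by rewrite (@mem_ker _ x x) ?(scheme_diag schS) // mem_diag Xx eqxx.
Qed.

(** A step along [K] does not change [phi], so a path through [p] and then [K] maps to a pair of
    [F p]. Conversely, lifting a pair of [F p] from [x] ends in the fibre of [z], one [K]-step away
    from [z]. *)
Lemma complex_prod_ker_r p r : p \in S -> r \in S ->
  (r \in complex_prod S [set p] K) = (F r == F p).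
Proof.
move=> Sp Sr; have pS : [set p] \subset S by rewrite sub1set.
apply/(complex_prodP schS pS ker_sub Sr)/eqP => [|Erp].
  case=> _ [k [x [y [z [/set1P-> Kk pxy kyz rxz]]]]].
  have Sk := subsetP ker_sub k Kk.
  apply: (rmap_determined Sr rxz (morphism_rel Sp)).
  rewrite (mem_ker Sk kyz) in Kk; rewrite -(eqP Kk).
  exact: morphism_pair.
have [x [z rxz]] := scheme_inhab schS Sr.
have [Xx Xz] := scheme_dom schS Sr rxz.
have := morphism_pair Sr rxz; rewrite Erp => Fxz.
have [y [Xy Ey pxy]] := lift_target Xx Sp Fxz.
have [k Sk kyz] := scheme_rel schS Xy Xz.
exists p, k, x, y, z; split=> //; first exact: set11.
by rewrite (mem_ker Sk kyz) Ey.
Qed.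

Lemma complex_prod_ker_l p r : p \in S -> r \in S ->
  (r \in complex_prod S K [set p]) = (F r == F p).
Proof.
move=> Sp Sr; have pS : [set p] \subset S by rewrite sub1set.
apply/(complex_prodP schS ker_sub pS Sr)/eqP => [|Erp].
  case=> k [_ [x [y [z [Kk /set1P-> kxy pyz rxz]]]]].
  have Sk := subsetP ker_sub k Kk.
  apply: (rmap_determined Sr rxz (morphism_rel Sp)).
  rewrite (mem_ker Sk kxy) in Kk; rewrite (eqP Kk).
  exact: morphism_pair.
have [x [z rxz]] := scheme_inhab schS Sr.
have [Xx Xz] := scheme_dom schS Sr rxz.
have := morphism_pair Sr rxz; rewrite Erp => Fxz.
have [y [Xy Ey pyz]] := lift_source Xz Sp Fxz.
have [k Sk kxy] := scheme_rel schS Xx Xy.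
exists k, p, x, y, z; split=> //; last exact: set11.
by rewrite (mem_ker Sk kxy) Ey.
Qed.

(** Normality holds because both products obey the same criterion. Closure is transitivity of having
    equal images, with [diag X] giving the reverse inclusion. *)
Lemma ker_normal_closed : normal_closed_subset S K.
Proof.
split; last first.
  move=> p Sp; apply/setP=> r; have [Sr | S'r] := boolP (r \in S).
    by rewrite complex_prod_ker_l // complex_prod_ker_r.
  by rewrite !inE (negbTE S'r).
split; first exact: ker_sub.
  by apply/set0Pn; exists (diag X); exact: diag_in_ker.
apply/eqP; rewrite eqEsubset; apply/andP; split; apply/subsetP=> r.
  move=> KKr; have Sr := subsetP (complex_prod_sub _ _ _) r KKr.
  have := complex_prodP schS ker_sub ker_sub Sr KKr.
  case=> p [q [x [y [z [Kp Kq pxy qyz rxz]]]]].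
  have [Sp Sq] := (subsetP ker_sub p Kp, subsetP ker_sub q Kq).
  rewrite (mem_ker Sr rxz); rewrite (mem_ker Sp pxy) in Kp.
  by rewrite (eqP Kp) -(mem_ker Sq qyz).
move=> Kr; have Sr := subsetP ker_sub r Kr.
have [x [z rxz]] := scheme_inhab schS Sr; have [Xx _] := scheme_dom schS Sr rxz.
apply/(complex_prodP schS ker_sub ker_sub Sr).
exists (diag X), r, x, x, z; split=> //; first exact: diag_in_ker.
by rewrite mem_diag Xx eqxx.
Qed.

(** * The image as a subscheme of the target *)

Lemma im_rel_sub : phiS \subset T.
Proof. by apply/subsetP=> _ /imsetP[s Ss ->]; apply: morphism_rel. Qed.

Lemma rmap_diag : F (diag X) = diag Y.
Proof. by have := diag_in_ker; rewrite inE => /andP[_ /eqP]. Qed.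

(* A path over [y0, y1, y2] in [T] can be moved to start at a pair of [phi X] *)
(* and then lifted to [X].                                                    *)
Lemma im_rel_closed : closed_subset T phiS.
Proof.
split; first exact: im_rel_sub.
  by apply/set0Pn; exists (F (diag X)); rewrite imset_f ?(scheme_diag schS).
apply/eqP; rewrite eqEsubset; apply/andP; split; apply/subsetP=> r.
  move=> FFr; have Tr := subsetP (complex_prod_sub _ _ _) r FFr.
  have := complex_prodP schT im_rel_sub im_rel_sub Tr FFr.
  case=> _ [_ [y0 [y1 [y2 [/imsetP[p Sp ->] /imsetP[q Sq ->] p01 q12 r02]]]]].
  have [x0 [x1 px01]] := scheme_inhab schS Sp.
  have [Xx0 Xx1] := scheme_dom schS Sp px01.
  have Fq := morphism_rel Sq.
  have q21 : (y2, y1) \in conv (F q) by rewrite mem_conv.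
  (* The triangle is read as a path along [r] and [conv (F q)] over a pair of [F p], so that it can
     be moved onto the image of a pair of [p]. *)
  have [y2' rx0 qy2] := path_transport schT Tr (scheme_conv schT Fq)
    (morphism_rel Sp) r02 q21 p01 (morphism_pair Sp px01).
  rewrite mem_conv in qy2; have [x2 [Xx2 Ex2 qx12]] := lift_target Xx1 Sq qy2.
  have [s Ss sx02] := scheme_rel schS Xx0 Xx2.
  by apply/imsetP; exists s => //; rewrite (rmap_determined Ss sx02 Tr) ?Ex2.
case/imsetP=> s Ss ->; have [x [y sxy]] := scheme_inhab schS Ss.
have [Xx _] := scheme_dom schS Ss sxy.
apply/(complex_prodP schT im_rel_sub im_rel_sub (morphism_rel Ss)).
exists (F (diag X)), (F s), (phi x), (phi x), (phi y).
rewrite !imset_f ?(scheme_diag schS) //; split=> //; try exact: morphism_pair.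
by rewrite rmap_diag mem_diag morphism_point /=.
Qed.

(** Any point of [X] is related to [x] by some [s], which gives one inclusion; lifting from [x]
    returns every neighbour under [phiS] to [phiX]. *)
Lemma im_gcoset x : x \in X -> phiX = gcoset (phi x) phiS.
Proof.
move=> Xx; apply/setP=> y.
apply/imsetP/bigcupP => [[x' Xx' ->] | [_ /imsetP[s Ss ->]]].
  have [s Ss sxx'] := scheme_rel schS Xx Xx'.
  by exists (F s); rewrite ?imset_f // inE morphism_pair.
rewrite inE => Fxy; have [x' [Xx' <- _]] := lift_target Xx Ss Fxy.
by exists x'.
Qed.

Definition im_rel s := F s :&: setX phiX phiX.

Lemma mem_im_rel s x y : x \in X -> y \in X ->
  ((phi x, phi y) \in im_rel s) = ((phi x, phi y) \in F s).
Proof. by move=> Xx Xy; rewrite inE in_setX !imset_f ?andbT. Qed.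

Lemma im_rel_inhab s : s \in S ->
  exists x y, [/\ x \in X, y \in X & (phi x, phi y) \in im_rel s].
Proof.
move=> Ss; have [x [y sxy]] := scheme_inhab schS Ss.
have [Xx Xy] := scheme_dom schS Ss sxy; exists x, y; split=> //.
by rewrite mem_im_rel ?morphism_pair.
Qed.

Lemma im_relP s y z : (y, z) \in im_rel s ->
  exists x1 x2,
    [/\ x1 \in X, x2 \in X, y = phi x1, z = phi x2 & (y, z) \in F s].
Proof.
rewrite !inE /= => /and3P[Fyz /imsetP[x1 Xx1 E1] /imsetP[x2 Xx2 E2]].
by exists x1, x2.
Qed.

(** A single pair surviving the restriction still identifies [F s]; this makes restriction to [phiX]
    invertible on [phiS]. *)
Lemma im_rel_determined s t y z : s \in S -> t \in T ->
  (y, z) \in im_rel s -> (y, z) \in t -> F s = t.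
Proof.
move=> Ss Tt /setIP[Fyz _] tyz.
exact: (scheme_uniq schT (morphism_rel Ss) Tt Fyz).
Qed.

(** The nonemptiness condition in [subscheme] holds for each [F s], since the image of a pair of [s]
    survives the restriction. *)
Lemma im_map_subscheme : im_map X S phi = subscheme phiS phiX.
Proof.
apply/setP=> t; apply/imsetP/imsetP => [[s Ss ->] | [t' t'S ->]].
  exists (F s) => //; rewrite inE imset_f //=.
  have [x [y [_ _ sxy]]] := im_rel_inhab Ss.
  by apply/set0Pn; exists (phi x, phi y).
by move: t'S; rewrite inE => /andP[/imsetP[s Ss ->] _]; exists s.
Qed.

Lemma im_map_scheme : is_scheme phiX (im_map X S phi).
Proof.
split.
- apply/and3P; split.
  + rewrite eqEsubset; apply/andP; split; apply/subsetP=> -[y z].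
      by case/bigcupP=> _ /imsetP[s _ ->] /setIP[].
    rewrite in_setX => /andP[/imsetP[x1 Xx1 ->] /imsetP[x2 Xx2 ->]].
    have [s Ss sx] := scheme_rel schS Xx1 Xx2.
    apply/bigcupP; exists (im_rel s); first exact: imset_f.
    by rewrite mem_im_rel ?morphism_pair.
  + apply/trivIsetP=> _ _ /imsetP[s Ss ->] /imsetP[t St ->].
    apply: contraNT => /pred0Pn[u /andP[/= /setIP[su _] /setIP[tu _]]].
    by rewrite (scheme_uniq schT (morphism_rel Ss) (morphism_rel St) su tu).
  + apply/imsetP=> -[s Ss s0]; have [x [y [_ _]]] := im_rel_inhab Ss.
    by rewrite /im_rel -s0 inE.
- apply/imsetP; exists (diag X); first exact: scheme_diag schS.
  rewrite rmap_diag; apply/setP=> -[y z].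
  rewrite mem_diag in_setI mem_diag in_setX.
  have [<-|_] := eqVneq y z; rewrite ?andbF // !andbT andbb.
  apply/idP/andP=> [phiXy | [] //]; split=> //.
  by case/imsetP: phiXy => x Xx ->; apply: morphism_point.
- move=> _ /imsetP[s Ss ->]; apply/imsetP; exists (conv s).
    exact: scheme_conv schS _ Ss.
  rewrite rmap_conv //; apply/setP=> -[y z].
  by rewrite mem_conv !in_setI !in_setX mem_conv [in RHS](andbC (_ \in phiX)).
move=> _ _ _ /imsetP[p Sp ->] /imsetP[q Sq ->] /imsetP[r Sr ->].
have Tp := morphism_rel Sp; have Tq := morphism_rel Sq.
have Tr := morphism_rel Sr.
(* The count is that of [T]: an intermediate point is reached from [phi x1] along [F p], so lifting
   puts it in [phiX]. *)
exists (structure_const (F p) (F q) (F r)) => y z.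
case/im_relP=> x1 [x2 [Xx1 Xx2 -> -> Fr]].
rewrite -(structure_constE schT Tp Tq Tr Fr); apply: eq_card => w.
rewrite !inE /= !imset_f ?andbT //=.
apply/andP/andP=> [[/andP[-> _] /andP[-> _]] | [pw ->]] //.
by have [x [Xx Ew _]] := lift_target Xx1 Sp pw; rewrite pw -Ew imset_f.
Qed.

(** * The quotient by the kernel as a pullback of the image *)

Lemma mem_gcosets_ker x : x \in X -> gcoset x K \in gcosets X K.
Proof. exact: imset_f. Qed.

Lemma eq_gcoset_ker x y : x \in X -> phi x = phi y -> y \in X ->
  gcoset x K = gcoset y K.
Proof. by move=> Xx Exy Xy; apply/setP=> z; rewrite !mem_gcoset_ker ?Exy. Qed.

(** [phi] is constant on cosets, so any related representatives give the pair of images. Conversely,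
    lifting from [x] itself reaches the fibre of [y], so the answer is independent of
    representatives. *)
Lemma mem_quotient_rel s x y : s \in S -> x \in X -> y \in X ->
  ((gcoset x K, gcoset y K) \in quotient_rel X K s) = ((phi x, phi y) \in F s).
Proof.
move=> Ss Xx Xy; rewrite inE in_setX !mem_gcosets_ker //=.
apply/exists_inP/idP=> [[x' xx' /exists_inP[y' yy' sxy]] | Fxy].
  move: xx' yy'; rewrite !mem_gcoset_ker // => /andP[_ /eqP->] /andP[_ /eqP->].
  exact: morphism_pair.
have [y' [Xy' Ey' sxy']] := lift_target Xx Ss Fxy.
exists x; first by rewrite mem_gcoset_ker ?Xx /=.
by apply/exists_inP; exists y'; rewrite // mem_gcoset_ker // Xy' Ey' /=.
Qed.

(* [x0] is only a default value: cosets of [K] are nonempty. *)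
Definition quotient_point x0 (W : {set U}) : V :=
  phi (odflt x0 [pick x in W]).

(** The picked point is arbitrary, but [phi] is constant on the coset; this is the well-definedness
    of the induced map on points. *)
Lemma quotient_pointE x0 x : x \in X -> quotient_point x0 (gcoset x K) = phi x.
Proof.
move=> Xx; rewrite /quotient_point; case: pickP => [z | /(_ x)].
  by rewrite mem_gcoset_ker // => /andP[_ /eqP].
by rewrite mem_gcoset_ker // Xx eqxx.
Qed.

Lemma quotient_point_inj x0 : {in gcosets X K &, injective (quotient_point x0)}.
Proof.
move=> _ _ /imsetP[x Xx ->] /imsetP[y Xy ->].
by rewrite !quotient_pointE // => /eq_gcoset_ker; apply.
Qed.

Lemma quotient_point_im x0 : quotient_point x0 @: gcosets X K = phiX.
Proof.
by rewrite -imset_comp; apply: eq_in_imset => x Xx /=; rewrite quotient_pointE.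
Qed.

(** On representatives [x] and [y], both sides say that [(phi x, phi y)] lies in [F s]. *)
Lemma quotient_rel_pull x0 s : s \in S ->
  quotient_rel X K s = pull_rel (quotient_point x0) (gcosets X K) (im_rel s).
Proof.
move=> Ss; apply/setP=> -[W1 W2]; rewrite mem_pull_rel.
have [XW | X'W] := boolP ((W1 \in gcosets X K) && (W2 \in gcosets X K));
  last first.
  by rewrite andbA (negbTE X'W) inE in_setX (negbTE X'W).
rewrite andbA XW /=; case/andP: XW => /imsetP[x Xx ->] /imsetP[y Xy ->].
by rewrite mem_quotient_rel // !quotient_pointE // mem_im_rel.
Qed.

Lemma push_quotient_rel x0 s : s \in S ->
  push_rel (quotient_point x0) (quotient_rel X K s) = im_rel s.
Proof.
move=> Ss; rewrite (quotient_rel_pull x0) // pull_relK //.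
by rewrite quotient_point_im subsetIr.
Qed.

Lemma quotient_ker_scheme : is_scheme (gcosets X K) (quotient_scheme X S K).
Proof.
have [x0 _] := scheme_pointed schS.
have -> : quotient_scheme X S K =
    pull_rel (quotient_point x0) (gcosets X K) @: im_map X S phi.
  rewrite /quotient_scheme /im_map -imset_comp.
  by apply: eq_in_imset => s Ss; apply: quotient_rel_pull.
apply: pull_scheme; first exact: quotient_point_inj.
by rewrite quotient_point_im; apply: im_map_scheme.
Qed.

(** * The induced isomorphism and the factorization *)

(** Pushing pairs forward depends only on the set [s^K], not on [s], so well-definedness on
    relations is built in. *)
Definition quotient_iso x0 : scheme_map {set U} V :=
  SchemeMap (quotient_point x0) (push_rel (quotient_point x0)).

Lemma quotient_iso_isomorphism x0 :
  is_isomorphism (gcosets X K) (quotient_scheme X S K) phiX (im_map X S phi)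
    (quotient_iso x0).
Proof.
split; first split.
- by move=> _ /imsetP[x Xx ->] /=; rewrite quotient_pointE ?imset_f.
- by move=> _ /imsetP[s Ss ->] /=; rewrite push_quotient_rel //; apply: imset_f.
- by move=> W1 W2 s _ sW /=; apply/imsetP; exists (W1, W2).
- exact: quotient_point_inj.
- exact: quotient_point_im.
- move=> _ _ /imsetP[s Ss ->] /imsetP[t St ->] /=.
  (* Equal restrictions have equal pullbacks, and these are the quotient relations. *)
  by rewrite !push_quotient_rel // !(quotient_rel_pull x0) // => ->.
rewrite -imset_comp; apply: eq_in_imset => s Ss /=.
exact: push_quotient_rel.
Qed.

(** Restriction to [phiX] is undone by choosing a member of [phiS] with the given trace; the default
    [set0] is never reached on [im phi]. *)
Definition im_inclusion : scheme_map V V :=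
  SchemeMap id
    (fun t => odflt set0 [pick t' in phiS | t' :&: setX phiX phiX == t]).

Lemma im_inclusion_rel s : s \in S -> rmap_of im_inclusion (im_rel s) = F s.
Proof.
move=> Ss /=.
case: pickP => [_ /andP[/imsetP[t St ->] /eqP Est] | /(_ (F s))] /=.
  (* Whichever member was chosen, it shares with [F s] a pair of their common trace, hence equals
     [F s]. *)
  have [x [y [_ _ sxy]]] := im_rel_inhab Ss.
  have /setIP[txy _] : (phi x, phi y) \in F t :&: setX phiX phiX by rewrite Est.
  exact/esym/(im_rel_determined Ss (morphism_rel St) sxy).
by rewrite imset_f // eqxx.
Qed.

Lemma im_inclusion_morphism : is_morphism phiX (im_map X S phi) Y T im_inclusion.
Proof.
split.
- by move=> _ /imsetP[x Xx ->]; apply: morphism_point.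
- by move=> _ /imsetP[s Ss ->]; rewrite im_inclusion_rel ?morphism_rel.
by move=> y z _ /imsetP[s Ss ->] /setIP[syz _]; rewrite im_inclusion_rel.
Qed.

Lemma quotient_map_morphism :
  is_morphism X S (gcosets X K) (quotient_scheme X S K) (quotient_map X K).
Proof.
split.
- exact: mem_gcosets_ker.
- by move=> s Ss; apply: imset_f.
move=> x y s Ss sxy; have [Xx Xy] := scheme_dom schS Ss sxy.
by rewrite /= mem_quotient_rel ?morphism_pair.
Qed.

End AdmissibleMorphism.

Theorem theorem4p5 (U V : finType)
    (X : {set U}) (S : {set {set U * U}})
    (Y : {set V}) (T : {set {set V * V}})
    (phi : scheme_map U V)
    (schemeS : is_scheme X S) (schemeT : is_scheme Y T)
    (morph_phi : is_morphism X S Y T phi)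
    (adm_phi : is_admissible X S Y phi) :
  let K := ker_map S Y phi in
  let phiX := phi @: X in
  let phiS := rmap_of phi @: S in
  let imphi := im_map X S phi in
  let piK := quotient_map X K in
  [/\ normal_closed_subset S K,
      [/\ closed_subset T phiS,
          phiX \in gcosets Y phiS,
          imphi = subscheme phiS phiX
        & is_scheme phiX imphi]
    & is_scheme (gcosets X K) (quotient_scheme X S K) /\
      exists (barphi : scheme_map {set U} V) (iota : scheme_map V V),
        [/\ (forall x, x \in X -> barphi (gcoset x K) = phi x) /\
            (forall s, s \in S ->
               rmap_of barphi (quotient_rel X K s)
               = rmap_of phi s :&: setX phiX phiX),
            is_isomorphism (gcosets X K) (quotient_scheme X S K)
              phiX imphi barphi,
            (forall y, y \in phiX -> iota y = y) /\
            (forall t, t \in phiS -> rmap_of iota (t :&: setX phiX phiX) = t),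
            is_morphism X S (gcosets X K) (quotient_scheme X S K) piK /\
            is_morphism phiX imphi Y T iota
          & eq_map_on X S phi (comp_map iota (comp_map barphi piK))]].
Proof.
(* [x0] serves both as the default inside [quotient_point] and as the base point of the coset
   [phiX]. *)
move=> K phiX phiS imphi piK; have [x0 Xx0] := scheme_pointed schemeS.
have isoE := push_quotient_rel schemeS schemeT morph_phi adm_phi x0.
have inclE := im_inclusion_rel schemeS schemeT morph_phi.
have pointE := quotient_pointE schemeS schemeT morph_phi x0.
split.
- exact: ker_normal_closed schemeS schemeT morph_phi adm_phi.
- split.
  + exact: im_rel_closed schemeS schemeT morph_phi adm_phi.
  + apply/imsetP; exists (phi x0); first exact: morphism_point morph_phi _ Xx0.
    exact: im_gcoset schemeS schemeT morph_phi adm_phi _ Xx0.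
  + exact: im_map_subscheme schemeS morph_phi.
  + exact: im_map_scheme schemeS schemeT morph_phi adm_phi.
split; first exact: quotient_ker_scheme schemeS schemeT morph_phi adm_phi.
exists (quotient_iso phi x0), (im_inclusion X S phi); split.
- by split=> [x | s]; [apply: pointE | apply: isoE].
- exact: quotient_iso_isomorphism schemeS schemeT morph_phi adm_phi x0.
- by split=> // _ /imsetP[s Ss ->]; apply: inclE.
- split; last exact: im_inclusion_morphism schemeS schemeT morph_phi.
  exact: quotient_map_morphism schemeS schemeT morph_phi adm_phi.
split=> [x Xx | s Ss]; first by rewrite /= pointE.
(* Unfolded backwards: [phi s] is the inclusion of its trace, which is the push-forward of [s^K]. *)
by rewrite -(inclE _ Ss) -(isoE _ Ss).
Qed.
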